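(* Let $\mathbb{F}$ be a field of characteristic $0$, let $n\ge3$ be an integer and let $k\in\mathbb{N}$. Let $\mathcal{H}_k$ be the space of homogeneous polynomials $f\in\mathbb{F}[x_1,\dots,x_n]$ of degree $k$ satisfying $(\partial_{x_1}^2+\cdots+\partial_{x_n}^2)(f)=0$. The set $$\Big\{\sum_{r_2,\dots,r_n=0}^{\infty}\frac{(-1)^{r_2+\cdots+r_n}\binom{r_2+\cdots+r_n}{r_2,\dots,r_n}\prod_{i=2}^n\binom{\ell_i}{2r_i}}{(1+2\epsilon(r_2+\cdots+r_n))\binom{2(r_2+\cdots+r_n)}{2r_2,\dots,2r_n}}\,x_1^{\epsilon+2(r_2+\cdots+r_n)}x_2^{\ell_2-2r_2}\cdots x_n^{\ell_n-2r_n}$$ $$\Big|\ \epsilon\in\{0,1\},\ \ell_2,\dots,\ell_n\in\mathbb{N},\ \epsilon+\sum_{i=2}^n\ell_i=k\Big\}$$ forms a basis of $\mathcal{H}_k$.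
   Context: $\mathbb{N}$ is the set of nonnegative integers. $\binom{N}{r_2,\dots,r_n}=\frac{N!}{r_2!\cdots r_n!}$ (with $r_2+\cdots+r_n=N$) is the multinomial coefficient; $\binom{\ell}{j}=0$ when $j>\ell\ge0$, and such terms are zero. *)

(* Defs.v *)
From HB Require Import structures.
From mathcomp Require Import all_boot all_order all_algebra.
From mathcomp Require Import zify.
From mathcomp.multinomials Require Export mpoly.

Set Implicit Arguments.
Unset Strict Implicit.
Unset Printing Implicit Defensive.

Import GRing.Theory.
Local Open Scope ring_scope.

(* Polynomials in n = m.+1 variables: x_1 is 'X_ord0 and x_(j+2) is
   'X_(lift ord0 j) for j : 'I_m.  Accordingly the families (l_2, ..., l_n) and
   (r_2, ..., r_n) are multi-indices in 'X_{1..m}, with mdeg their sum. *)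

Section Laplacian.
Variables (n : nat) (F : fieldType).
Implicit Types (p : {mpoly F[n]}).

Definition laplacian p : {mpoly F[n]} := \sum_(i < n) p^`M(i)^`M(i).

Lemma laplacian_is_linear : linear laplacian.
Proof.
move=> c p q; rewrite scaler_sumr -big_split /=.
by apply: eq_bigr => i _; rewrite !linearP.
Qed.

HB.instance Definition _ := GRing.isLinear.Build F {mpoly F[n]} {mpoly F[n]} _
  laplacian laplacian_is_linear.

Lemma mderiv_homog d i p : p \is d.-homog -> p^`M(i) \is d.-1.-homog.
Proof.
move=> /dhomogP hp; rewrite /mderiv big_seq; apply: rpred_sum => s sp.
have [->|si0] := posnP (s i); first by rewrite mul0r scale0r dhomog0.
apply: dhomogZ; rewrite dhomogX /=; have <- : mdeg s = d := hp _ sp.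
have le_s : (U_(i) <= s)%MM by apply/mnm_lepP => j; rewrite mnm1E; case: eqP => [<-|].
by have := mdegD (s - U_(i))%MM U_(i)%MM; rewrite submK // mdeg1 addn1 => ->.
Qed.

Lemma laplacian_homog d p : p \is d.-homog -> laplacian p \is d.-2.-homog.
Proof. by move=> hp; apply: rpred_sum => i _; do 2!apply: mderiv_homog. Qed.

End Laplacian.

Section Harmonic.
Variables (m : nat) (F : fieldType) (k : nat).

(* For k < 2 the truncated degree k.-2 is harmless, the Laplacian being 0. *)
Definition dhomog_laplacian (f : dhomog m.+1 F k) : dhomog m.+1 F k.-2 :=
  DHomog (laplacian_homog (dhomog_is_dhomog f)).

Lemma dhomog_laplacian_is_linear : linear dhomog_laplacian.
Proof. by move=> c f g; apply: val_inj; rewrite /= !linearP. Qed.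

HB.instance Definition _ := GRing.isLinear.Build F (dhomog m.+1 F k)
  (dhomog m.+1 F k.-2) _ dhomog_laplacian dhomog_laplacian_is_linear.

Definition harmonic : {vspace dhomog m.+1 F k} := lker (linfun dhomog_laplacian).

Lemma mem_harmonic (f : dhomog m.+1 F k) :
  (f \in harmonic) = (laplacian (val f) == 0).
Proof. by rewrite memv_ker lfunE. Qed.

End Harmonic.

Definition multinomial m (r : 'X_{1..m}) : nat :=
  (mdeg r)`! %/ \prod_(i < m) (r i)`!.

Lemma multinomial_fact m (r : 'X_{1..m}) :
  (multinomial r * \prod_(i < m) (r i)`! = (mdeg r)`!)%N.
Proof.
rewrite divnK // mdegE; elim/big_rec2: _ => // i a b _ dvd_ab.
apply: (dvdn_trans (dvdn_mul (dvdnn _) dvd_ab)).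
rewrite -(@bin_fact (r i + b) (r i)) ?leq_addr // addKn.
exact: dvdn_mull.
Qed.

Section HarmonicFamily.
Variables (m : nat) (F : fieldType).
Implicit Types (e : bool) (l r : 'X_{1..m}).

Definition hcoef e l r : F :=
  ((-1) ^+ mdeg r * (multinomial r)%:R * \prod_(i < m) 'C(l i, 2 * r i)%:R)
  / ((1 + 2 * e * mdeg r)%N%:R * (multinomial [multinom (2 * r i)%N | i < m])%:R).

(* The truncated subtraction l i - 2 * r i only matters when hcoef vanishes. *)
Definition hmon e l r : {mpoly F[m.+1]} :=
  'X_ord0 ^+ (e + 2 * mdeg r)%N
  * \prod_(i < m) 'X_(lift ord0 i) ^+ (l i - 2 * r i)%N.

(* The sum over all r_2, ..., r_n >= 0 is truncated to r_2 + ... + r_n <= mdeg l;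
   by hpoly_widen the omitted terms are all zero. *)
Definition hpoly e l : {mpoly F[m.+1]} :=
  \sum_(r : 'X_{1..m < (mdeg l).+1}) hcoef e l r *: hmon e l r.

Lemma hcoef_eq0 e l r i : (l i < 2 * r i)%N -> hcoef e l r = 0.
Proof.
move=> lt_lr; rewrite /hcoef [X in _ * X / _](bigD1 i) //= bin_small //.
by rewrite mul0r mulr0 mul0r.
Qed.

Lemma hcoef_supp e l r : hcoef e l r != 0 -> forall i, (2 * r i <= l i)%N.
Proof. by move=> nz i; rewrite leqNgt; apply: contraNN nz => /hcoef_eq0->. Qed.

Lemma hcoef_deg e l r : hcoef e l r != 0 -> (mdeg r < (mdeg l).+1)%N.
Proof.
move=> /hcoef_supp le_rl; rewrite ltnS !mdegE; apply: leq_sum => i _.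
by have := le_rl i; lia.
Qed.

Lemma hpoly_widen e l N : (mdeg l < N)%N ->
  hpoly e l = \sum_(r : 'X_{1..m < N}) hcoef e l r *: hmon e l r.
Proof.
move=> lt_lN; pose P r := hcoef e l r != 0.
have restr M : \sum_(r : 'X_{1..m < M}) hcoef e l r *: hmon e l r
    = \sum_(r : 'X_{1..m < M} | P r) hcoef e l r *: hmon e l r.
  by rewrite [RHS]big_rmcond // => r /negPn/eqP->; rewrite scale0r.
rewrite /hpoly !restr; apply/esym.
pose h (r : 'X_{1..m < (mdeg l).+1}) : 'X_{1..m < N} :=
  BMultinom (leq_trans (bmdeg r) lt_lN).
pose h' (r : 'X_{1..m < N}) : 'X_{1..m < (mdeg l).+1} := insubd bm0 (val r).
rewrite (reindex_onto h h') //=; last first.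
  by move=> r /hcoef_deg lt_r; apply/val_inj; rewrite /= /h' val_insubd lt_r.
by apply: eq_bigl => r; rewrite /h' valKd eqxx andbT.
Qed.

Lemma hpoly_homog e l : hpoly e l \is (e + mdeg l)%N.-homog.
Proof.
apply: rpred_sum => r _.
have [->|/hcoef_supp le_rl] := eqVneq (hcoef e l r) 0.
  by rewrite scale0r dhomog0.
apply: dhomogZ; rewrite /hmon mpolyXn mprodXnE -mpolyXD dhomogX /= mdegD mdegMn mdeg1 mdeg_sum.
under eq_bigr do rewrite mdegMn mdeg1 mul1n.
rewrite mul1n -addnA eqn_add2l; apply/eqP; rewrite !mdegE big_distrr -big_split /=.
by rewrite [RHS]mdegE; apply: eq_bigr => i _; rewrite subnKC.
Qed.

Variable k : nat.

(* The bound on mdeg only makes the type finite: it follows from the equation. *)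
Definition hindex :=
  {el : bool * 'X_{1..m < k.+1} | (el.1 + mdeg el.2 == k)%N}.

Lemma hbasis_subproof (a : hindex) : hpoly (val a).1 (val a).2 \is k.-homog.
Proof. by have := hpoly_homog (val a).1 (val a).2; rewrite (eqP (valP a)). Qed.

Definition hbasis (a : hindex) : dhomog m.+1 F k := DHomog (hbasis_subproof a).

End HarmonicFamily.

(* Main.v *)
(* Multiply the coefficient of x^s by the product of the (s_i)!; in these
   divided-power coefficients g the Laplacian shifts indices: p is harmonic iff
   sum_i g(s + 2 e_i) = 0 for all s. This recursion expresses g at x_1-degree
   a + 2 through g at x_1-degree a, so a harmonic polynomial is determined by
   its coefficients of x_1-degree 0 and 1. For hpoly e l the only nonzero g sit at
   (e + 2 |r|, l - 2 r), with value (-1)^|r| l! multinomial(r), and harmonicity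
   is Pascal's rule for multinomials. Since hpoly e l has x^(e, l) as its only
   monomial of x_1-degree at most 1, with coefficient 1, the coefficients of
   x_1-degree 0 and 1 are the coordinates of a basis. *)
Require Import Defs.
From HB Require Import structures.
From mathcomp Require Import all_boot all_order all_algebra.
From mathcomp Require Import ring zify.

Set Implicit Arguments.
Unset Strict Implicit.
Unset Printing Implicit Defensive.

Import GRing.Theory.
Local Open Scope ring_scope.

(** * Factorials of multi-indices and Pascal's rule *)

Definition mfact n (s : 'X_{1..n}) : nat := \prod_(i < n) (s i)`!.

Lemma mfact_gt0 n (s : 'X_{1..n}) : (0 < mfact s)%N.
Proof. by rewrite prodn_gt0 // => i; rewrite fact_gt0. Qed.

Lemma mfactDU n (s : 'X_{1..n}) i :
  mfact (s + U_(i))%MM = ((s i).+1 * mfact s)%N.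
Proof.
rewrite /mfact (bigD1 i) //= [in RHS](bigD1 i) //= mulnA mnmDE mnm1E eqxx addn1.
rewrite factS; congr (_ * _)%N; apply: eq_bigr => j.
by rewrite mnmDE mnm1E eq_sym => /negPf->; rewrite addn0.
Qed.

Lemma multinomial0 m : multinomial (0%MM : 'X_{1..m}) = 1%N.
Proof.
rewrite /multinomial mdeg0 big1 // => i _.
by rewrite mnm0E.
Qed.

(** Multiplied by [mfact r], the [i]-th summand becomes [r i * (mdeg r - 1)!], and the [r i] add up
    to [mdeg r]. Indices with [r i = 0] are left out because there the truncated [r - U_(i)] would
    be [r] itself. *)
Lemma multinomial_rec m (r : 'X_{1..m}) : r != 0%MM ->
  multinomial r = (\sum_(i < m | (0 < r i)%N) multinomial (r - U_(i))%MM)%N.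
Proof.
move=> r_neq0; apply/eqP; rewrite -(eqn_pmul2r (mfact_gt0 r)) multinomial_fact.
have [d def_d] : exists d, mdeg r = d.+1.
  by exists (mdeg r).-1; rewrite prednK // lt0n mdeg_eq0.
rewrite def_d factS -def_d -/(mfact r) [X in (X * _)%N]mdegE.
rewrite !big_distrl /= [eqbRHS]big_mkcond /=.
apply/eqP/eq_bigr => i _; case: posnP => [->|ri_gt0]; first by rewrite mul0n.
have le_Ur : (U_(i) <= r)%MM.
  by apply/mnm_lepP => j; rewrite mnm1E; case: eqP => [<-|].
have def_r := submK le_Ur; rewrite -{3}def_r mfactDU mulnCA multinomial_fact.
congr (_ * _)%N; first by rewrite mnmBE mnm1E eqxx; lia.
by congr _`!; apply/eqP; rewrite -eqSS -def_d -{1}def_r mdegD mdeg1 addn1.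
Qed.

(** * Divided-power coefficients, on which derivatives act as shifts *)

Section DividedCoefficients.
Variables (n : nat) (F : fieldType).
Implicit Types (p : {mpoly F[n]}) (s : 'X_{1..n}).

Definition dcoef p s : F := (mfact s)%:R * p@_s.

Lemma dcoef_deriv i p s : dcoef p^`M(i) s = dcoef p (s + U_(i))%MM.
Proof. by rewrite /dcoef mcoeff_deriv mfactDU -mulr_natr natrM; ring. Qed.

Lemma dcoef_laplacian p s :
  dcoef (laplacian p) s = \sum_(i < n) dcoef p (s + U_(i) + U_(i))%MM.
Proof.
rewrite {1}/dcoef raddf_sum mulr_sumr; apply: eq_bigr => i _.
by rewrite -!dcoef_deriv.
Qed.

(** In characteristic 0 the factorials are invertible, so passing to [dcoef] loses no
    information. *)
Lemma dcoef_eq0 (charF0 : [pchar F] =i pred0) p s :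
  (dcoef p s == 0) = (p@_s == 0).
Proof.
by rewrite /dcoef mulf_eq0 ((pcharf0P F).1 charF0) (gtn_eqF (mfact_gt0 s)).
Qed.

End DividedCoefficients.

(** * Exponents split into the [x_1]-degree and the rest *)

Section ConsMonomial.
Variable m : nat.
Implicit Types (a : nat) (t : 'X_{1..m}) (s : 'X_{1..m.+1}).

Definition mcons a t : 'X_{1..m.+1} :=
  [multinom if unlift ord0 j is Some i then t i else a | j < m.+1].

Lemma mcons_ord0 a t : mcons a t ord0 = a.
Proof. by rewrite mnmE unlift_none. Qed.

Lemma mcons_lift a t i : mcons a t (lift ord0 i) = t i.
Proof. by rewrite mnmE liftK. Qed.

Lemma mconsP s : exists a t, s = mcons a t.
Proof.
exists (s ord0), [multinom s (lift ord0 i) | i < m]; apply/mnmP => j.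
by case: (unliftP ord0 j) => [i|] ->; rewrite ?mcons_lift ?mcons_ord0 ?mnmE.
Qed.

Lemma mcons_inj a1 a2 t1 t2 : mcons a1 t1 = mcons a2 t2 -> a1 = a2 /\ t1 = t2.
Proof.
move=> /mnmP eq12; split; first by have := eq12 ord0; rewrite !mcons_ord0.
by apply/mnmP => i; have := eq12 (lift ord0 i); rewrite !mcons_lift.
Qed.

Lemma mfact_mcons a t : mfact (mcons a t) = (a`! * mfact t)%N.
Proof.
rewrite /mfact big_ord_recl mcons_ord0; congr (_ * _)%N.
by apply: eq_bigr => i _; rewrite mcons_lift.
Qed.

Lemma mdeg_mcons a t : mdeg (mcons a t) = (a + mdeg t)%N.
Proof.
rewrite !mdegE big_ord_recl mcons_ord0; congr (_ + _)%N.
by apply: eq_bigr => i _; rewrite mcons_lift.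
Qed.

Lemma mconsDU0 a t : (mcons a t + U_(ord0))%MM = mcons a.+1 t.
Proof.
apply/mnmP => j; rewrite mnmDE mnm1E.
case: (unliftP ord0 j) => [i|] ->; rewrite ?mcons_lift ?mcons_ord0 ?addn1 //.
by rewrite addn0.
Qed.

Lemma mconsDU_lift a t i :
  (mcons a t + U_(lift ord0 i))%MM = mcons a (t + U_(i))%MM.
Proof.
apply/mnmP => j; rewrite mnmDE mnm1E.
case: (unliftP ord0 j) => [h|] ->; rewrite ?mcons_lift ?mcons_ord0 ?addn0 //.
by rewrite mnmDE mnm1E (inj_eq lift_inj).
Qed.

End ConsMonomial.

Lemma dcoef_laplacian_mcons m (F : fieldType) (p : {mpoly F[m.+1]}) a t :
  dcoef (laplacian p) (mcons a t) = dcoef p (mcons a.+2 t)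
    + \sum_(i < m) dcoef p (mcons a (t + U_(i) + U_(i))%MM).
Proof.
rewrite dcoef_laplacian big_ord_recl !mconsDU0; congr (_ + _).
by apply: eq_bigr => i _; rewrite !mconsDU_lift.
Qed.

Lemma laplacian_eq0_mpoly0 m (F : fieldType) (p : {mpoly F[m.+1]}) :
    [pchar F] =i pred0 -> laplacian p = 0 ->
    (forall (e : bool) t, p@_(mcons e t) = 0) -> p = 0.
Proof.
move=> charF0 lap_p init0.
(* The recursion raises the [x_1]-degree by two, so the induction carries two consecutive
   degrees. *)
have dcoef0 a : forall t, dcoef p (mcons a t) = 0 /\ dcoef p (mcons a.+1 t) = 0.
  elim: a => [|a IHa] t.
    by rewrite /dcoef (init0 false) (init0 true) !mulr0.
  split; first by have [] := IHa t.
  have := dcoef_laplacian_mcons p a t; rewrite lap_p big1 => [|i _].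
    by rewrite addr0 /dcoef mcoeff0 mulr0.
  by have [] := IHa (t + U_(i) + U_(i))%MM.
apply/mpolyP => s; have [a [t ->]] := mconsP s; rewrite mcoeff0.
by apply/eqP; rewrite -dcoef_eq0 // (dcoef0 a t).1.
Qed.

(** * Support, coefficients and harmonicity of [hpoly] *)

Section HarmonicFamilyCoefficients.
Variables (m : nat) (F : fieldType).
Implicit Types (e : bool) (l r t : 'X_{1..m}).

Lemma hmonE e l r :
  hmon F e l r = 'X_[mcons (e + 2 * mdeg r) (l - r *+ 2)].
Proof.
rewrite mpolyXE_id big_ord_recl mcons_ord0; congr (_ * _).
by apply: eq_bigr => i _; rewrite mcons_lift mnmBE mulmnE mulnC.
Qed.

Lemma mcoeff_hpoly_neq0 e l a t : (hpoly F e l)@_(mcons a t) != 0 ->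
  exists2 r, a = (e + 2 * mdeg r)%N & l = (t + r *+ 2)%MM.
Proof.
rewrite raddf_sum /= => nz.
have /existsP[r] : [exists r : 'X_{1..m < (mdeg l).+1},
    (hcoef F e l r *: hmon F e l r)@_(mcons a t) != 0].
  apply: contraNT nz; rewrite negb_exists => /forallP z.
  by apply/eqP/big1 => r _; apply/eqP; have := z r; rewrite negbK.
rewrite mcoeffZ hmonE mcoeffX mulf_eq0 negb_or => /andP[/hcoef_supp le_rl].
case: (_ =P mcons a t) => [/mcons_inj[<- <-] _|]; last by rewrite eqxx.
exists r => //; rewrite submK //; apply/mnm_lepP => i.
by rewrite mulmnE mulnC.
Qed.

Lemma mcoeff_hpoly e r t :
  (hpoly F e (t + r *+ 2)%MM)@_(mcons (e + 2 * mdeg r) t)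
    = hcoef F e (t + r *+ 2)%MM r.
Proof.
set l := (t + r *+ 2)%MM.
have lt_rl : (mdeg r < (mdeg l).+1)%N by rewrite /l mdegD mdegMn; lia.
rewrite raddf_sum /= (bigD1 (BMultinom lt_rl)) //= big1 ?addr0 => [|r' ne_r'].
  by rewrite mcoeffZ hmonE mcoeffX /l addmK eqxx mulr1.
rewrite mcoeffZ hmonE mcoeffX; case: eqP => [/mcons_inj[_ def_t]|]; last first.
  by rewrite mulr0.
(* Truncated subtraction could make another [r'] yield the same monomial, but then [hcoef] vanishes;
   otherwise [2 r' <= l] forces [r' = r]. *)
have [->|/hcoef_supp le_r'l] := eqVneq (hcoef F e l r') 0; first by rewrite mul0r.
case/eqP: ne_r'; apply/val_inj/mnmP => i /=.
have := le_r'l i; move/mnmP/(_ i): def_t.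
by rewrite mnmBE mulmnE /l mnmDE mulmnE; lia.
Qed.

(* Multiplying by the factorials turns hcoef into a multinomial coefficient, up
   to sign and to a factor depending on l only. *)
Lemma dcoef_hpoly (charF0 : [pchar F] =i pred0) e r t :
  dcoef (hpoly F e (t + r *+ 2)%MM) (mcons (e + 2 * mdeg r) t)
    = (-1) ^+ mdeg r * (mfact (t + r *+ 2)%MM)%:R * (multinomial r)%:R.
Proof.
rewrite /dcoef mcoeff_hpoly mfact_mcons /hcoef.
set l := (t + r *+ 2)%MM; set M := multinomial _; set N := multinomial _.
have natF n : (0 < n)%N -> n%:R != 0 :> F.
  by move=> n_gt0; rewrite ((pcharf0P F).1 charF0) gtn_eqF.
pose B := (\prod_(i < m) 'C(l i, 2 * r i))%N.
have -> : \prod_(i < m) 'C(l i, 2 * r i)%:R = B%:R :> F by rewrite natr_prod.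
(* [P] is the common denominator of the binomials and of the multinomial [N], so it cancels. *)
pose P := (\prod_(i < m) (2 * r i)`!)%N.
have def_l : (B * P * mfact t = mfact l)%N.
  rewrite -!big_split; apply: eq_bigr => i _ /=.
  have le_i : (2 * r i <= l i)%N by rewrite mnmDE mulmnE; lia.
  rewrite -(bin_fact le_i) mulnA; congr (_ * _`!)%N.
  by rewrite mnmDE mulmnE; lia.
have P_gt0 : (0 < P)%N by apply: prodn_gt0 => i; rewrite fact_gt0.
have def_N : (N * P = (2 * mdeg r)`!)%N.
  have := multinomial_fact [multinom (2 * r i)%N | i < m].
  rewrite -/N; have -> : mdeg [multinom (2 * r i)%N | i < m] = (2 * mdeg r)%N.
    by rewrite !mdegE big_distrr; apply: eq_bigr => i _; rewrite mnmE.
  by move=> <-; congr (_ * _)%N; apply: eq_bigr => i _; rewrite mnmE.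
have N_gt0 : (0 < N)%N.
  by have := fact_gt0 (2 * mdeg r); rewrite -def_N muln_gt0 => /andP[].
(* The factorial of the [x_1]-degree is exactly what cancels the denominator of [hcoef], the factor
   [1 + 2 * e * mdeg r] included. *)
have def_e : ((e + 2 * mdeg r)`! = (1 + 2 * e * mdeg r) * (N * P))%N.
  rewrite def_N; case: (e) => /=; last by rewrite muln0 mul0n addn0 mul1n.
  by rewrite muln1 factS.
have D_gt0 : (0 < 1 + 2 * e * mdeg r)%N by [].
move: (1 + 2 * e * mdeg r)%N D_gt0 def_e => D D_gt0 ->.
by rewrite -def_l !natrM; field; rewrite !natF.
Qed.

Lemma laplacian_hpoly (charF0 : [pchar F] =i pred0) e l :
  laplacian (hpoly F e l) = 0.
Proof.
apply/mpolyP => s; have [a [t ->]] := mconsP s; rewrite mcoeff0.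
apply/eqP; rewrite -dcoef_eq0 // dcoef_laplacian_mcons; apply: contraT => nz.
(* If any term of the recursion is nonzero, its support condition fixes [r]; a nonzero term at
   [t + 2 U_(i)] yields [r] after adding [U_(i)]. *)
have [r def_a def_l] : exists2 r, a.+2 = (e + 2 * mdeg r)%N & l = (t + r *+ 2)%MM.
  have [z0|/mcoeff_hpoly_neq0//] := eqVneq (hpoly F e l)@_(mcons a.+2 t) 0.
  have /existsP[i] : [exists i, (hpoly F e l)@_(mcons a (t + U_(i) + U_(i))) != 0].
    apply: contraNT nz; rewrite negb_exists => /forallP z.
    rewrite /dcoef z0 mulr0 add0r big1 // => i _.
    by have := z i; rewrite negbK => /eqP->; rewrite mulr0.
  move=> /mcoeff_hpoly_neq0[r -> ->]; exists (r + U_(i))%MM.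
    by rewrite mdegD mdeg1; lia.
  by apply/mnmP => j; rewrite !(mnmDE, mulmnE); lia.
have r_neq0 : r != 0%MM by rewrite -mdeg_eq0; apply/eqP; lia.
(* The [i]-th term belongs to [r - U_(i)], whose degree is one less, hence the minus sign. If
   [r i = 0] then [t i + 2] exceeds [l i], so the term is outside the support. *)
have termE i : dcoef (hpoly F e l) (mcons a (t + U_(i) + U_(i))%MM)
    = - ((-1) ^+ mdeg r * (mfact l)%:R
         * (if (0 < r i)%N then multinomial (r - U_(i))%MM else 0%N)%:R).
  case: posnP => [ri0|ri_gt0].
    rewrite mulr0 oppr0; apply/eqP; rewrite dcoef_eq0 //.
    apply: contraT => /mcoeff_hpoly_neq0[r' _].
    rewrite def_l => /mnmP/(_ i).
    by rewrite !(mnmDE, mulmnE) mnm1E eqxx ri0; lia.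
  have le_Ur : (U_(i) <= r)%MM.
    by apply/mnm_lepP => j; rewrite mnm1E; case: eqP => [<-|].
  have def_r := submK le_Ur; move: (r - U_(i))%MM def_r => r' def_r.
  have def_l' : l = (t + U_(i) + U_(i) + r' *+ 2)%MM.
    by rewrite def_l -def_r; apply/mnmP => j; rewrite !(mnmDE, mulmnE); lia.
  have deg_r : mdeg r = (mdeg r').+1 by rewrite -def_r mdegD mdeg1 addn1.
  have -> : a = (e + 2 * mdeg r')%N by lia.
  by rewrite {1}def_l' dcoef_hpoly // -def_l' deg_r exprS; ring.
apply: contraNT nz => _.
rewrite {1}def_l def_a dcoef_hpoly // -def_l multinomial_rec // big_mkcond /=.
rewrite natr_sum mulr_sumr -big_split /= big1 ?eqxx // => i _.
by rewrite termE subrr.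
Qed.

Lemma mcoeff_hpoly_diag e l : (hpoly F e l)@_(mcons e l) = 1.
Proof.
have mul0 : (0 *+ 2 = 0 :> 'X_{1..m})%MM.
  by apply/mnmP => i; rewrite mulmnE mnm0E.
have := mcoeff_hpoly e 0 l; rewrite mul0 addm0 mdeg0 addn0 => ->.
rewrite /hcoef multinomial0 mdeg0 expr0 muln0 addn0 !mul1r.
have -> : [multinom (2 * 0%MM i)%N | i < m] = 0%MM.
  by apply/mnmP => i; rewrite mnmE mnm0E muln0.
rewrite multinomial0 big1 ?divr1 // => i _.
by rewrite mnm0E muln0 bin0.
Qed.

Lemma mcoeff_hpoly_dual e e' l l' :
  (hpoly F e l)@_(mcons e' l') = ((e, l) == (e', l'))%:R.
Proof.
have [[<- <-]|] := (e, l) =P (e', l'); first exact: mcoeff_hpoly_diag.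
move=> neq; apply/eqP; apply: contra_notT neq => /mcoeff_hpoly_neq0[r def_e' ->].
(* Here [e' = e + 2 * mdeg r] is at most 1. *)
have /eqP : mdeg r = 0%N by move: def_e'; case: (e); case: (e'); lia.
rewrite mdeg_eq0 => /eqP r0; congr (_, _).
  by move: def_e'; rewrite r0 mdeg0 addn0; case: (e); case: (e').
by apply/mnmP => i; rewrite r0 mnmDE mulmnE mnm0E addn0.
Qed.

End HarmonicFamilyCoefficients.

(** Spanning: [u] minus the sum of the [phi i u *: v i] lies in [U] and is killed by every [phi i],
    so it is 0. Freeness: [phi i] applied to a relation isolates its [i]-th coefficient. *)
Lemma basis_of_dual (K : fieldType) (V : vectType K) (I : finType) (v : I -> V)
    (phi : I -> {scalar V}) (U : {vspace V}) :
    (forall i, v i \in U) -> (forall i j, phi i (v j) = (j == i)%:R) ->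
    (forall u, u \in U -> (forall i, phi i u = 0) -> u = 0) ->
  basis_of U [seq v i | i : I].
Proof.
move=> vU phi_v phi_inj; apply/andP; split.
  rewrite eqEsubv; apply/andP; split.
    by apply/span_subvP => _ /mapP[i _ ->].
  apply/subvP => u uU; pose w := \sum_i phi i u *: v i.
  have wU : w \in U by apply: memv_suml => i _; apply: memvZ.
  have -> : u = w.
    apply/eqP; rewrite -subr_eq0; apply/eqP/phi_inj => [|i]; first exact: memvB.
    rewrite linearB linear_sum (bigD1 i) //= linearZ /= phi_v eqxx mulr1.
    rewrite big1 ?addr0 ?subrr // => j ne_ji.
    by rewrite linearZ /= phi_v (negPf ne_ji) mulr0.
  by apply: memv_suml => i _; apply/memvZ/memv_span/map_f; rewrite mem_enum.
rewrite -[X in free X]/(tval (image_tuple v I)).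
apply/freeP => c sum0 i.
have := congr1 (phi (enum_val i)) sum0; rewrite linear0 linear_sum (bigD1 i) //=.
rewrite linearZ /= nth_image phi_v eqxx mulr1 big1 ?addr0 // => j ne_ji.
by rewrite linearZ /= nth_image phi_v (inj_eq enum_val_inj) (negPf ne_ji) mulr0.
Qed.

(** * Coefficient functionals and the basis of harmonic polynomials *)

Section HarmonicBasis.
Variables (F : fieldType) (m k : nat).

Definition dhomog_mcoeff (s : 'X_{1..m.+1}) (f : dhomog m.+1 F k) : F :=
  (val f)@_s.

Lemma dhomog_mcoeff_is_linear s : linear_for *%R (dhomog_mcoeff s).
Proof. by move=> c f g; rewrite /dhomog_mcoeff !linearP. Qed.

HB.instance Definition _ s := GRing.isLinear.Build F (dhomog m.+1 F k) F _
  (dhomog_mcoeff s) (dhomog_mcoeff_is_linear s).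

End HarmonicBasis.

Theorem theorem4p1 (F : fieldType) (charF0 : [pchar F] =i pred0)
    (m : nat) (n_ge3 : (3 <= m.+1)%N) (k : nat) :
  basis_of (harmonic m F k) [seq hbasis F a | a : hindex m k].
Proof.
pose phi (a : hindex m k) : {scalar dhomog m.+1 F k} :=
  dhomog_mcoeff (mcons (val a).1 (val a).2).
apply: (@basis_of_dual _ _ _ _ phi) => [a|a b|f].
- by rewrite mem_harmonic /= laplacian_hpoly.
- rewrite -val_eqE; case: a b => [[e l] el_k] [[e' l'] el'_k].
  exact: mcoeff_hpoly_dual.
rewrite mem_harmonic => /eqP lap_f phi_f.
apply/val_inj/(laplacian_eq0_mpoly0 charF0 lap_f) => e t /=.
(* Homogeneity kills the coefficients of degree other than [k]; those of degree [k] are values of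
   the functionals [phi]. *)
have [deg_et|] := eqVneq (e + mdeg t)%N k; last first.
  rewrite -mdeg_mcons; apply: dhomog_nemf_coeff.
  exact: dhomog_is_dhomog.
have lt_tk : (mdeg t < k.+1)%N by lia.
have et_k : ((e, BMultinom lt_tk).1 + mdeg (e, BMultinom lt_tk).2 == k)%N.
  by rewrite /= deg_et.
exact: (phi_f (Sub (e, BMultinom lt_tk) et_k)).
Qed.
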